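(* Let $N\ge 3$ and let $\Gamma^n$ ($n=0,1,2,\dots$) be $N$-sided polygonal Jordan curves in $\mathbb{R}^2$ with vertices $\bm{X}_1^n,\dots,\bm{X}_N^n$. Suppose that the vertices of the initial curve are allocated uniformly, i.e. $r_i^0=|\bm{X}_i^0-\bm{X}_{i-1}^0|$ does not depend on $i$, and that the curves evolve according to the fully discrete evolution law $$\frac{\bm{X}_i^{n+1}-\bm{X}_i^{n}}{\Delta t^{n}}=\overline{V}_i\,\overline{\bm{N}}_i+\overline{W}_i\,\overline{\bm{T}}_i,\qquad i=1,\dots,N,\ n=0,1,\dots,$$ where $\Delta t^n>0$ are the time step sizes, and where, for each $n$, the quantities $\overline{\bm{N}}_i,\overline{\bm{T}}_i,\overline{V}_i$ are those defined in the context for the pair $\Gamma=\Gamma^{n+1}$, $\hat\Gamma=\Gamma^n$ and given real edge normal velocities $\overline{v}_1,\dots,\overline{v}_N$ (which may depend on $n$, $\Gamma^n$ and $\Gamma^{n+1}$), and the tangential velocities $\overline{W}_i$ satisfy the asymptotic uniform distribution condition stated in the context (with $\Delta t=\Delta t^n$). Then $$\frac{\mathcal{L}[\Gamma^{n+1}]-\mathcal{L}[\Gamma^{n}]}{\Delta t^{n}}=\sum_{i=1}^N\kappa_i^{n+1/2}v_i^{n+1/2}r_i^{n+1/2}$$ as long as $\overline{G}_i=0$ for all $i$ (where $\overline G_i$ is defined in the context for the pair $\Gamma=\Gamma^{n+1}$, $\hat\Gamma=\Gamma^n$). Here $\kappa_i^{n+1/2},v_i^{n+1/2},r_i^{n+1/2}$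 denote the quantities $\overline{\kappa}_i,\overline{v}_i,\overline{r}_i$ for the pair $\Gamma=\Gamma^{n+1}$, $\hat\Gamma=\Gamma^n$.
   Context: All indices $i$ are understood periodically modulo $N$. $J=\begin{pmatrix}0&-1\\1&0\end{pmatrix}$. An $N$-sided polygonal Jordan curve $\Gamma$ with vertices $\bm{X}_i\in\mathbb{R}^2$ has edges $\Gamma_i$ joining $\bm{X}_{i-1}$ to $\bm{X}_i$, and it is oriented counterclockwise. Its length is $\mathcal{L}[\Gamma]=\sum_{i=1}^N|\bm{X}_i-\bm{X}_{i-1}|$. Let $\Gamma,\hat\Gamma$ be two such curves with vertices $\bm{X}_i$ and $\hat{\bm{X}}_i$. Put $r_i=|\bm{X}_i-\bm{X}_{i-1}|$ and $\hat r_i=|\hat{\bm{X}}_i-\hat{\bm{X}}_{i-1}|$. Let $\overline{\bm{X}}_i=(\bm{X}_i+\hat{\bm{X}}_i)/2$ be the vertices of the midpoint polygon $\overline\Gamma$, with edges $\overline\Gamma_i$ joining $\overline{\bm{X}}_{i-1}$ to $\overline{\bm{X}}_i$. Put $$\overline r_i=|\overline{\bm{X}}_i-\overline{\bm{X}}_{i-1}|,\qquad \overline{\bm{t}}_i=(\overline{\bm{X}}_i-\overline{\bm{X}}_{i-1})/\overline r_i,\qquad \overline{\bm{n}}_i=-J\overline{\bm{t}}_i.$$ Let $\overline\varphi_i$ be the signed angle from $\overline{\bm{t}}_i$ to $\overline{\bm{t}}_{i+1}$. It is assumed that $\overline r_i>0$ and $\overline\varphi_i\in(-\pi,\pi)$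 for all $i$. Put $$\bm{d}_i=\frac{\overline{\bm{X}}_i-\overline{\bm{X}}_{i-1}}{(r_i+\hat r_i)/2},$$ a vector that is not necessarily of unit length. Normal and tangent vectors at vertices: $$\overline{\bm{N}}_i=-\operatorname{sgn}(\overline\varphi_i)\,\frac{\bm{d}_{i+1}-\bm{d}_i}{|\bm{d}_{i+1}-\bm{d}_i|}\ \text{ if }\overline\varphi_i\neq0,\qquad \overline{\bm{N}}_i=-J\overline{\bm{t}}_i\ \text{ if }\overline\varphi_i=0,\qquad \overline{\bm{T}}_i=J\overline{\bm{N}}_i.$$ Quantities $\overline F_i,\overline G_i$: - $\overline F_i=-\dfrac{|\bm{d}_{i+1}-\bm{d}_i|}{\operatorname{sgn}\overline\varphi_i}$ if $\overline\varphi_i\ne0$, and $\overline F_i=0$ if $\overline\varphi_i=0$. - $\overline G_i=0$ if $\overline\varphi_i\neq0$, or if $\overline\varphi_i=0$ and $|\bm{d}_{i+1}|=|\bm{d}_i|$. - $\overline G_i=|\bm{d}_{i+1}-\bm{d}_i|$ if $\overline\varphi_i=0$ and $|\bm{d}_{i+1}|>|\bm{d}_i|$. - $\overline G_i=-|\bm{d}_{i+1}-\bm{d}_i|$ if $\overline\varphi_i=0$ and $|\bm{d}_{i+1}|<|\bm{d}_i|$. Coefficients $\overline\alpha_i,\overline\beta_i$: if $\overline\varphi_i\ne0$, they are the unique real numbers with $\overline{\bm{N}}_i=\overline\alpha_i\overline{\bm{n}}_i+\overline\beta_i\overline{\bm{n}}_{i+1}$. If $\overline\varphi_i=0$, then $\overline\alpha_i=\overline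 r_i/(\overline r_i+\overline r_{i+1})$ and $\overline\beta_i=\overline r_{i+1}/(\overline r_i+\overline r_{i+1})$. Given normal velocities $\overline v_i\in\mathbb{R}$ on edges, the normal velocities on vertices are $\overline V_i=\overline\alpha_i\overline v_i+\overline\beta_i\overline v_{i+1}$. The discrete curvature on $\overline\Gamma_i$ is $$\overline\kappa_i=-\frac{\overline F_i\overline\alpha_i+\overline F_{i-1}\overline\beta_{i-1}}{\overline r_i}.$$ Asymptotic uniform distribution condition on the tangential velocities $\overline W_i\in\mathbb{R}$, with a real relaxation parameter $\omega$: for $i=2,3,\dots,N$, $$\frac{\overline r_i(\overline{\bm{t}}_i\cdot\overline{\bm{T}}_i)}{(r_i+\hat r_i)/2}\overline W_i-\frac{\overline r_i(\overline{\bm{t}}_i\cdot\overline{\bm{T}}_{i-1})}{(r_i+\hat r_i)/2}\overline W_{i-1}=-\frac{\overline r_i(\overline{\bm{t}}_i\cdot\overline{\bm{N}}_i)}{(r_i+\hat r_i)/2}\overline V_i+\frac{\overline r_i(\overline{\bm{t}}_i\cdot\overline{\bm{N}}_{i-1})}{(r_i+\hat r_i)/2}\overline V_{i-1}+\frac1N\frac{\mathcal{L}[\Gamma]-\mathcal{L}[\hat\Gamma]}{\Delta t}+\Big(\frac{\mathcal{L}[\Gamma]}{N}-r_i\Big)\omega .$$ *)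

(* Defs.v *)
From mathcomp Require Import all_boot all_order all_algebra.
From mathcomp Require Import classical_sets reals trigo.
From mathcomp Require Import ring.

Set Implicit Arguments.
Unset Strict Implicit.
Unset Printing Implicit Defensive.

Import Order.TTheory GRing.Theory Num.Theory.

Local Open Scope ring_scope.

Section Plane.
Variable R : realType.
Implicit Types u v : 'cV[R]_2.

Definition dot u v : R := \sum_(k < 2) u k 0 * v k 0.

(* The norm [`|u|] of the library on matrices is the sup norm. *)
Definition enorm u : R := Num.sqrt (dot u u).

(* the counterclockwise rotation by pi / 2, with rows (0, -1) and (1, 0) *)
Definition J : 'M[R]_2 :=
  \matrix_(i, j) if i == j then 0 else if (i < j)%N then -1 else 1.

(* Signed angle in ]-pi, pi] from the unit vector u to the unit vector v;
   [dot (J *m u) v] is the determinant det(u, v). *)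
Definition signed_angle u v : R :=
  if 0 <= dot (J *m u) v then acos (dot u v) else - acos (dot u v).

Lemma dotE u v : dot u v = u 0 0 * v 0 0 + u 1 0 * v 1 0.
Proof. by rewrite /dot big_ord_recl big_ord1; congr (_ + u _ _ * v _ _); apply/val_inj. Qed.

Lemma J0E u : (J *m u) 0 0 = - u 1 0.
Proof.
rewrite mxE big_ord_recl big_ord1 !mxE /= mul0r add0r mulN1r.
by congr (- u _ _); apply/val_inj.
Qed.

Lemma J1E u : (J *m u) 1 0 = u 0 0.
Proof. by rewrite mxE big_ord_recl big_ord1 !mxE /= mul1r mul0r addr0. Qed.

(* [signed_angle u v] is the angle in ]-pi, pi] of the rotation taking the unit
   vector u to the unit vector v. *)
Lemma signed_angleP u v : dot u u = 1 -> dot v v = 1 ->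
  let phi := signed_angle u v in
  [/\ - pi < phi, phi <= pi & v = cos phi *: u + sin phi *: (J *m u)].
Proof.
move=> hu hv /=; rewrite /signed_angle.
have eJ : dot (J *m u) v = u 0 0 * v 1 0 - u 1 0 * v 0 0.
  by rewrite dotE J0E J1E; ring.
have e2 : dot (J *m u) v ^+ 2 = 1 - dot u v ^+ 2.
  have -> : 1 - dot u v ^+ 2 = dot u u * dot v v - dot u v ^+ 2.
    by rewrite hu hv mulr1.
  by rewrite eJ !dotE; ring.
have hs : sin (acos (dot u v)) = `|dot (J *m u) v| /\ -1 <= dot u v <= 1.
  have hd : -1 <= dot u v <= 1.
    rewrite -ler_norml -(@ler_pXn2r _ 2) ?nnegrE // expr1n real_normK ?num_real //.
    by rewrite -subr_ge0 -e2 sqr_ge0.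
  by rewrite sin_acos // -e2 sqrtr_sqr.
case: hs => hs hd.
have hv' : v = dot u v *: u + dot (J *m u) v *: (J *m u).
  have h0 : v 0 0 = dot u v * u 0 0 + dot (J *m u) v * (J *m u) 0 0.
    by rewrite J0E -[LHS]mul1r -hu eJ !dotE; ring.
  have h1 : v 1 0 = dot u v * u 1 0 + dot (J *m u) v * (J *m u) 1 0.
    by rewrite J1E -[LHS]mul1r -hu eJ !dotE; ring.
  apply/matrixP => i j; rewrite ord1 [RHS]mxE [X in _ = X + _]mxE [X in _ + X]mxE.
  have [->|->] // : i = 0 \/ i = 1.
  by case: i => [[|[|//]] hi]; [left|right]; apply/val_inj.
have cK : cos (acos (dot u v)) = dot u v by rewrite acosK // in_itv.
have pi0 := @pi_gt0 R.
case: ifPn => hJ.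
  split; [|exact: acos_lepi|].
  - by rewrite (lt_le_trans _ (acos_ge0 hd)) // oppr_lt0.
  - by rewrite cK hs ger0_norm.
move: hJ; rewrite -ltNge => hJ.
split.
- rewrite ltrN2 acos_ltpi //; case/andP: hd => hd ->; rewrite andbT lt_neqAle hd andbT.
  apply/eqP => h; move: e2; rewrite -h sqrrN expr1n subrr => /eqP.
  by rewrite sqrf_eq0 lt_eqF.
- by rewrite (@le_trans _ _ 0) ?oppr_le0 ?acos_ge0 // ltW.
- by rewrite cosN sinN cK hs ltr0_norm // opprK.
Qed.

End Plane.

Arguments J {R}.

(* A polygon is given by its vertices [X : 'I_N -> 'cV[R]_2]; an ordinal stands
   for its residue class modulo N, so that vertex number N is the one of index 0.
   The cyclic neighbours of i are [ordS i] and [ord_pred i]. *)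

Section Polygon.
Variables (R : realType) (N : nat).
Implicit Types X : 'I_N -> 'cV[R]_2.

Definition edge_point X (i : 'I_N) (s : R) : 'cV[R]_2 :=
  (1 - s) *: X (ord_pred i) + s *: X i.

(* The closed polygonal path, parametrised by the circle cut into the half-open
   unit intervals of its edges, is injective. *)
Definition simple_polygon X : Prop :=
  forall (i j : 'I_N) (s t : R), 0 <= s < 1 -> 0 <= t < 1 ->
    edge_point X i s = edge_point X j t -> i = j /\ s = t.

(* The shoelace formula; its sign is positive for a simple polygon exactly when
   the vertices are numbered counterclockwise. *)
Definition signed_area X : R :=
  2^-1 * \sum_(i < N) dot (J *m X (ord_pred i)) (X i).

Definition polygonal_jordan_curve X : Prop :=
  simple_polygon X /\ 0 < signed_area X.

Definition edge_length X (i : 'I_N) : R := enorm (X i - X (ord_pred i)).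

Definition curve_length X : R := \sum_(i < N) edge_length X i.

Definition midpoint_polygon X Xh (i : 'I_N) : 'cV[R]_2 := 2^-1 *: (X i + Xh i).

End Polygon.

Section Pair.
Variables (R : realType) (N : nat) (X Xh : 'I_N -> 'cV[R]_2).
Implicit Types i : 'I_N.

Let Xb := midpoint_polygon X Xh.

Definition rbar i : R := edge_length Xb i.

Definition tbar i : 'cV[R]_2 := (rbar i)^-1 *: (Xb i - Xb (ord_pred i)).

Definition nbar i : 'cV[R]_2 := - (J *m tbar i).

Definition phibar i : R := signed_angle (tbar i) (tbar (ordS i)).

Definition rmean i : R := (edge_length X i + edge_length Xh i) / 2.

Definition dvec i : 'cV[R]_2 := (rmean i)^-1 *: (Xb i - Xb (ord_pred i)).

Definition ddiff i : 'cV[R]_2 := dvec (ordS i) - dvec i.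

Definition Nbar i : 'cV[R]_2 :=
  if phibar i == 0 then - (J *m tbar i)
  else - Num.sg (phibar i) *: ((enorm (ddiff i))^-1 *: ddiff i).

Definition Tbar i : 'cV[R]_2 := J *m Nbar i.

Definition Fbar i : R :=
  if phibar i == 0 then 0 else - (enorm (ddiff i) / Num.sg (phibar i)).

Definition Gbar i : R :=
  if phibar i != 0 then 0
  else if enorm (dvec (ordS i)) == enorm (dvec i) then 0
  else if enorm (dvec i) < enorm (dvec (ordS i)) then enorm (ddiff i)
  else - enorm (ddiff i).

(* The pair (alpha, beta) with Nbar i = alpha nbar i + beta nbar (i + 1), which
   exists and is unique when the signed angle is not 0 or pi. *)
Definition normal_coefs i : R * R :=
  xget (0, 0) [set ab : R * R |
    Nbar i = ab.1 *: nbar i + ab.2 *: nbar (ordS i)]%classic.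

Definition alphabar i : R :=
  if phibar i == 0 then rbar i / (rbar i + rbar (ordS i))
  else (normal_coefs i).1.

Definition betabar i : R :=
  if phibar i == 0 then rbar (ordS i) / (rbar i + rbar (ordS i))
  else (normal_coefs i).2.

Definition Vbar (v : 'I_N -> R) i : R :=
  alphabar i * v i + betabar i * v (ordS i).

Definition kappabar i : R :=
  - ((Fbar i * alphabar i + Fbar (ord_pred i) * betabar (ord_pred i)) / rbar i).

Definition nondegenerate_pair : Prop :=
  forall i, 0 < rbar i /\ - pi < phibar i < pi.

(* Only the edge number 1 is left out, i.e. i ranges over 2, ..., N. *)
Definition asymptotic_uniform_distribution
    (v W : 'I_N -> R) (dt omega : R) : Prop :=
  forall i, i != 1%N :> nat ->
    rbar i * dot (tbar i) (Tbar i) / rmean i * W i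
    - rbar i * dot (tbar i) (Tbar (ord_pred i)) / rmean i * W (ord_pred i)
    = - (rbar i * dot (tbar i) (Nbar i) / rmean i) * Vbar v i
      + rbar i * dot (tbar i) (Nbar (ord_pred i)) / rmean i
        * Vbar v (ord_pred i)
      + N%:R^-1 * ((curve_length X - curve_length Xh) / dt)
      + (curve_length X / N%:R - edge_length X i) * omega.

End Pair.

(* Main.v *)
Require Import Defs.
From mathcomp Require Import all_boot all_order all_algebra.
From mathcomp Require Import reals.
From mathcomp Require Import trigo ring lra.

Import Order.TTheory GRing.Theory Num.Theory.
Local Open Scope ring_scope.

(** The two ideas are an exact discrete chain rule for the length and a
    summation by parts.

    Since d_i is the sum of the old and the new edge vector divided by the sum
    of their lengths, the difference of squares |e|^2 - |e'|^2 = (e - e').(e + e')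
    gives r_i - r'_i = d_i . (e_i - e'_i) without any error term
    ([edge_length_sub]).  Here e_i - e'_i is the difference of the displacements
    of the two end points of the edge, so that a cyclic summation by parts turns
    the change of length into - sum_i (d_{i+1} - d_i) . (X_i - X'_i)
    ([curve_length_sub]).

    The vector d_{i+1} - d_i plays the role of the curvature vector, and it is
    normal: d_{i+1} - d_i = F_i N_i ([ddiff_Fbar_Nbar]).  At a vertex with a
    nonzero angle this is the way in which F_i and N_i were chosen; at a flat
    vertex d_i and d_{i+1} point in the same direction, and G_i = 0 says that
    they are equal.  Hence the tangential velocities do no work, and the rate of
    change of length is - sum_i F_i V_i.  Expanding V_i = alpha_i v_i +
    beta_i v_{i+1} and collecting the coefficient of each v_i gives
    sum_i kappa_i v_i r_i. *)

(** * Euclidean geometry of the plane *)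

Section Plane.
Set Implicit Arguments.
Unset Strict Implicit.
Variable R : realType.
Implicit Types u v w : 'cV[R]_2.

Lemma dotDr u v w : dot u (v + w) = dot u v + dot u w.
Proof. by rewrite !dotE !mxE; ring. Qed.

Lemma dotBr u v w : dot u (v - w) = dot u v - dot u w.
Proof. by rewrite !dotE !mxE; ring. Qed.

Lemma dotBl u v w : dot (u - v) w = dot u w - dot v w.
Proof. by rewrite !dotE !mxE; ring. Qed.

Lemma dotZl (a : R) u v : dot (a *: u) v = a * dot u v.
Proof. by rewrite !dotE !mxE; ring. Qed.

Lemma dotZr (a : R) u v : dot u (a *: v) = a * dot u v.
Proof. by rewrite !dotE !mxE; ring. Qed.

Lemma dot_J u : dot u (J *m u) = 0.
Proof. by rewrite dotE J0E J1E; ring. Qed.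

Lemma dot_ge0 u : 0 <= dot u u.
Proof. by rewrite dotE -!expr2 addr_ge0 ?sqr_ge0. Qed.

Lemma enorm_ge0 u : 0 <= enorm u.
Proof. exact: sqrtr_ge0. Qed.

Lemma sqr_enorm u : enorm u ^+ 2 = dot u u.
Proof. by rewrite sqr_sqrtr ?dot_ge0. Qed.

Lemma enorm0_eq0 u : enorm u = 0 -> u = 0.
Proof.
move=> u0; have := sqr_enorm u.
rewrite u0 expr0n dotE -!expr2 => /esym/eqP.
rewrite paddr_eq0 ?sqr_ge0 // !sqrf_eq0 => /andP[/eqP h0 /eqP h1].
apply/matrixP => i j; rewrite ord1 [RHS]mxE.
have [->|->] // : i = 0 \/ i = 1.
by case: i => [[|[|//]] hi]; [left | right]; apply/val_inj.
Qed.

Lemma enormZ (a : R) u : enorm (a *: u) = `|a| * enorm u.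
Proof. by rewrite /enorm dotZl dotZr mulrA -expr2 sqrtrM ?sqr_ge0 // sqrtr_sqr. Qed.

Lemma signed_angle_eq0 u v : dot u u = 1 -> dot v v = 1 ->
  signed_angle u v = 0 -> v = u.
Proof.
move=> u1 v1 uv0; have [_ _] := signed_angleP u1 v1.
by rewrite uv0 cos0 sin0 scale1r scale0r addr0.
Qed.

(** The difference of two squares, divided by the sum of the norms.  The
    quotient keeps its meaning when that sum is zero, since the inverse of zero
    is zero and both vectors then vanish. *)
Lemma enorm_sub u v :
  enorm u - enorm v = (enorm u + enorm v)^-1 * dot (u + v) (u - v).
Proof.
have -> : dot (u + v) (u - v) = (enorm u + enorm v) * (enorm u - enorm v).
  by rewrite mulrC -subr_sqr !sqr_enorm !dotE !mxE; ring.
have [s0|s0] := eqVneq (enorm u + enorm v) 0; last by rewrite mulKf.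
have := enorm_ge0 u; have := enorm_ge0 v.
by rewrite s0 invr0 mul0r => hv hu; lra.
Qed.

End Plane.

(** * Cyclic sums *)

Section CyclicSums.
Set Implicit Arguments.
Unset Strict Implicit.
Variables (R : realType) (N : nat).

Lemma sum_ord_pred (f : 'I_N -> R) :
  \sum_(i < N) f (ord_pred i) = \sum_(i < N) f i.
Proof. by rewrite [RHS](reindex_inj (@ord_pred_inj N)). Qed.

Lemma dot_sum_by_parts (f g : 'I_N -> 'cV[R]_2) :
  \sum_(i < N) dot (f i) (g i - g (ord_pred i)) =
  - \sum_(i < N) dot (f (ordS i) - f i) (g i).
Proof.
under eq_bigr do rewrite dotBr.
under [in RHS]eq_bigr do rewrite dotBl.
rewrite !sumrB opprB; congr (_ - _).
rewrite -(sum_ord_pred (fun i => dot (f (ordS i)) (g i))).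
by apply: eq_bigr => i _; rewrite ord_predK.
Qed.

End CyclicSums.

(** * The length of a pair of polygons *)

Section Pair.
Set Implicit Arguments.
Unset Strict Implicit.
Variables (R : realType) (N : nat) (X Xh : 'I_N -> 'cV[R]_2).
Implicit Types i : 'I_N.

Lemma edge_length_sub i :
  edge_length X i - edge_length Xh i =
  dot (dvec X Xh i) ((X i - Xh i) - (X (ord_pred i) - Xh (ord_pred i))).
Proof.
rewrite /edge_length enorm_sub /dvec /rmean /edge_length dotZl invfM invrK.
rewrite -mulrA; congr (_ * _).
by rewrite /midpoint_polygon !dotE !mxE; field.
Qed.

Lemma curve_length_sub :
  curve_length X - curve_length Xh =
  - \sum_(i < N) dot (ddiff X Xh i) (X i - Xh i).
Proof.
rewrite /curve_length -sumrB.
rewrite -(dot_sum_by_parts (dvec X Xh) (fun i => X i - Xh i)).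
by apply: eq_bigr => i _; rewrite edge_length_sub.
Qed.

Lemma rmean_ge0 i : 0 <= rmean X Xh i.
Proof. by rewrite divr_ge0 // addr_ge0 // enorm_ge0. Qed.

Hypothesis r_gt0 : forall i, 0 < rbar X Xh i.

Lemma tbar_unit i : dot (tbar X Xh i) (tbar X Xh i) = 1.
Proof.
rewrite -sqr_enorm /tbar enormZ normfV gtr0_norm ?r_gt0 //.
by rewrite mulVf ?expr1n // gt_eqF ?r_gt0.
Qed.

Lemma dvec_tbar i :
  dvec X Xh i = ((rmean X Xh i)^-1 * rbar X Xh i) *: tbar X Xh i.
Proof. by rewrite /tbar scalerA mulfK // gt_eqF ?r_gt0. Qed.

Lemma enorm_dvec i : enorm (dvec X Xh i) = (rmean X Xh i)^-1 * rbar X Xh i.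
Proof.
rewrite dvec_tbar enormZ /enorm tbar_unit sqrtr1 mulr1 ger0_norm //.
by rewrite mulr_ge0 ?invr_ge0 ?rmean_ge0 // ltW ?r_gt0.
Qed.

(** At a flat vertex the two vectors have the same direction, so that they are
    equal as soon as their lengths agree, and otherwise the value of [Gbar] is
    the length of their difference up to sign. *)
Lemma flat_ddiff_eq0 i :
  phibar X Xh i = 0 -> Gbar X Xh i = 0 -> ddiff X Xh i = 0.
Proof.
move=> phi0; rewrite /Gbar phi0 eqxx /=.
have tE : tbar X Xh (ordS i) = tbar X Xh i.
  by apply: signed_angle_eq0 phi0; exact: tbar_unit.
case: eqP => [len _|_].
  by rewrite /ddiff !dvec_tbar -!enorm_dvec len tE subrr.
case: ifP => _ g0; apply: enorm0_eq0 => //.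
by rewrite -[LHS]opprK g0 oppr0.
Qed.

Lemma ddiff_Fbar_Nbar i :
  Gbar X Xh i = 0 -> ddiff X Xh i = Fbar X Xh i *: Nbar X Xh i.
Proof.
move=> g0; rewrite /Fbar /Nbar; case: eqP => [phi0|/eqP phi0].
  by rewrite scale0r flat_ddiff_eq0.
have sg0 : Num.sg (phibar X Xh i) != 0 by rewrite sgr_eq0.
have [d0|d0] := eqVneq (enorm (ddiff X Xh i)) 0.
  by rewrite (enorm0_eq0 d0) !scaler0.
rewrite !scalerA mulrNN divfK // divff //.
by rewrite scale1r.
Qed.

(** [Nbar] is a unit vector except where [ddiff] vanishes at a vertex with a
    nonzero angle, and there [Fbar] is zero. *)
Lemma Fbar_dot_Nbar i :
  Fbar X Xh i * dot (Nbar X Xh i) (Nbar X Xh i) = Fbar X Xh i.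
Proof.
rewrite /Fbar /Nbar; case: eqP => [_|/eqP phi0]; first by rewrite mul0r.
have [d0|d0] := eqVneq (enorm (ddiff X Xh i)) 0.
  by rewrite d0 mul0r oppr0 mul0r.
rewrite -[RHS]mulr1; congr (_ * _).
transitivity (Num.sg (phibar X Xh i) ^+ 2); last by rewrite sqr_sg phi0.
by rewrite !dotZl !dotZr -sqr_enorm; field.
Qed.

Lemma dot_ddiff_velocity i (a b : R) : Gbar X Xh i = 0 ->
  dot (ddiff X Xh i) (a *: Nbar X Xh i + b *: Tbar X Xh i) = Fbar X Xh i * a.
Proof.
move=> g0; rewrite (ddiff_Fbar_Nbar g0) dotZl dotDr !dotZr /Tbar dot_J mulr0 addr0.
by rewrite mulrCA Fbar_dot_Nbar mulrC.
Qed.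

(** Transposition of the averaging operator from edge to vertex velocities: the
    curvature of an edge collects the contributions of its two end points. *)
Lemma sum_Fbar_Vbar (v : 'I_N -> R) :
  - \sum_(i < N) Fbar X Xh i * Vbar X Xh v i =
  \sum_(i < N) kappabar X Xh i * v i * rbar X Xh i.
Proof.
have kE i : kappabar X Xh i * v i * rbar X Xh i =
    - (Fbar X Xh i * alphabar X Xh i * v i
       + Fbar X Xh (ord_pred i) * betabar X Xh (ord_pred i) * v i).
  rewrite /kappabar mulrAC mulNr divfK ?gt_eqF ?r_gt0 //.
  by rewrite mulNr mulrDl.
under [in RHS]eq_bigr do rewrite kE.
rewrite sumrN big_split /=; congr (- _).
under eq_bigr do rewrite /Vbar mulrDr !mulrA.
rewrite big_split /=; congr (_ + _).
rewrite -(sum_ord_pred (fun i => _ * v (ordS i))).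
by apply: eq_bigr => i _; rewrite ord_predK.
Qed.

End Pair.

Theorem theorem4p2 (R : realType) (N : nat) (hN : (3 <= N)%N)
    (X : nat -> 'I_N -> 'cV[R]_2)
    (dt : nat -> R) (omega : R) (v W : nat -> 'I_N -> R)
    (hX : forall n, polygonal_jordan_curve (X n))
    (hdt : forall n, 0 < dt n)
    (hunif : forall i j, edge_length (X 0%N) i = edge_length (X 0%N) j)
    (hnd : forall n, nondegenerate_pair (X n.+1) (X n))
    (hevol : forall n i,
      (dt n)^-1 *: (X n.+1 i - X n i) =
        Vbar (X n.+1) (X n) (v n) i *: Nbar (X n.+1) (X n) i
        + W n i *: Tbar (X n.+1) (X n) i)
    (haud : forall n,
      asymptotic_uniform_distribution (X n.+1) (X n) (v n) (W n) (dt n) omega)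
    (n : nat) (hG : forall i, Gbar (X n.+1) (X n) i = 0) :
  (curve_length (X n.+1) - curve_length (X n)) / dt n =
    \sum_(i < N) kappabar (X n.+1) (X n) i * v n i * rbar (X n.+1) (X n) i.
Proof.
have r_gt0 i : 0 < rbar (X n.+1) (X n) i by have [] := hnd n i.
rewrite -sum_Fbar_Vbar // curve_length_sub mulNr mulr_suml; congr (- _).
apply: eq_bigr => i _.
by rewrite mulrC -dotZr hevol dot_ddiff_velocity.
Qed.
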